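(* Let $e\ge 0$ and $t>1$ be integers, $q=(2e+1)t$, $d_1=\gcd(2e+1,t)$ and $h_1=\frac{2e+1}{d_1}$. Every integer matrix of the form $$M=\begin{pmatrix}2e+1 & kh_1\\ 0 & 2e+1\end{pmatrix},\qquad k\in\mathbb{Z},$$ is a generator matrix of some type $2$ perfect code $C\in LPL^{\infty}(2,e,q)_o$. Conversely, every type $2$ perfect code $C\in LPL^{\infty}(2,e,q)_o$ has a generator matrix of this form.
   Context: For $a\in\mathbb{Z}_q$ with representative $\tilde a\in\{0,\dots,q-1\}$ put $|a|_1=\min\{\tilde a,q-\tilde a\}$. The maximum metric on $\mathbb{Z}_q^n$ is $d(x,y)=\max_i|x_i-y_i|_1$, and $B(x,r)=\{y\in\mathbb{Z}_q^n: d(x,y)\le r\}$. $LPL^{\infty}(n,e,q)$ is the set of linear perfect codes with packing radius $e$, i.e. of subgroups $C$ of $(\mathbb{Z}_q^n,+)$ with $\#C>1$ such that $\mathbb{Z}_q^n$ is the disjoint union of the balls $B(c,e)$, $c\in C$. A code $C\subseteq \mathbb{Z}_q^n$ is of type $i$ if $C+(2e+1)e_i\subseteq C$, where $e_i$ is the $i$-th canonical vector. $LPL^{\infty}(2,e,q)_o$ is the set of codes in $LPL^{\infty}(2,e,q)$ that are of type $2$. A generator matrix of a linear code $C\subseteq\mathbb{Z}_q^n$ is a matrix $M\in\mathcal{M}_n(\mathbb{Z})$ whose rows form a $\mathbb{Z}$-basis of the lattice $\Lambda_C=\pi^{-1}(C)$, where $\pi:\mathbb{Z}^n\to\mathbb{Z}_q^n$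 is reduction modulo $q$ in each coordinate. *)

(* Defs.v *)
From mathcomp Require Import all_boot all_order all_algebra.

Set Implicit Arguments.
Unset Strict Implicit.
Unset Printing Implicit Defensive.

Import GRing.Theory.
Local Open Scope ring_scope.

(* Words of length n over Z_q are row vectors 'rV['Z_q]_n.  'Z_q is the ring
   of integers modulo q only for q > 1 ('Z_0 and 'Z_1 are Z/2). *)

(* The coercion of a : 'Z_q to nat is its representative in {0, ..., q - 1}. *)
Definition absZ (q : nat) (a : 'Z_q) : nat := minn a (q - a).

Definition dist_max (q n : nat) (x y : 'rV['Z_q]_n) : nat :=
  (\max_(i < n) absZ (x ord0 i - y ord0 i)%R)%N.

Definition ball_max (q n : nat) (x : 'rV['Z_q]_n) (r : nat) : {set 'rV['Z_q]_n} :=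
  [set y | (dist_max x y <= r)%N].

Definition LPL (n e q : nat) (C : {set 'rV['Z_q]_n}) : Prop :=
  [/\ zmod_closed C,
      (1 < #|C|)%N,
      \bigcup_(c in C) ball_max c e = [set: 'rV['Z_q]_n]
    & {in C &, forall c c', c != c' -> [disjoint ball_max c e & ball_max c' e]}].

Definition of_type (n e q : nat) (i : 'I_n) (C : {set 'rV['Z_q]_n}) : Prop :=
  [set c + (2 * e + 1)%:R *: delta_mx ord0 i | c in C] \subset C.

(* Coordinates are indexed from 0, so ord_max : 'I_2 is the second one. *)
Definition LPL2_o (e q : nat) (C : {set 'rV['Z_q]_2}) : Prop :=
  LPL e C /\ of_type e (ord_max : 'I_2) C.

Definition mod_vec (q n : nat) (v : 'rV[int]_n) : 'rV['Z_q]_n :=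
  map_mx (fun z : int => z%:~R) v.

Definition code_lattice (q n : nat) (C : {set 'rV['Z_q]_n}) : pred 'rV[int]_n :=
  [pred v | mod_vec q v \in C].

Definition rows_Zbasis (m n : nat) (M : 'M[int]_(m, n)) (L : pred 'rV[int]_n) : Prop :=
  (forall v : 'rV[int]_n,
     v \in L <-> exists a : 'I_m -> int, v = \sum_(i < m) a i *: row i M)
  /\ (forall a : 'I_m -> int,
     \sum_(i < m) a i *: row i M = 0 -> forall i, a i = 0).

Definition generator_matrix (q n : nat) (C : {set 'rV['Z_q]_n}) (M : 'M[int]_n) : Prop :=
  rows_Zbasis M (code_lattice C).

Definition mx2 (a b c d : int) : 'M[int]_2 :=
  \matrix_(i < 2, j < 2)
    if i == ord0 then (if j == ord0 then a else b)
    else (if j == ord0 then c else d).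

(* Main.v *)
Require Import Defs.
From mathcomp Require Import all_boot all_order all_algebra.
From mathcomp Require Import zify ring.
Import GRing.Theory.
Local Open Scope ring_scope.

(** Everything is read in the lattice [L] of integer vectors lying over [C].
    Since [2e < q], the code is perfect exactly when each integer vector has a
    point of [L] within sup-distance [e], and [0] is the only point of [L] in
    the cube of radius [2e] ([LPL_latticeP]).  Write [m = 2e+1].

    Suppose [C] is perfect of type 2, so that [(0, m)] is in [L].  A point of
    [L] whose first coordinate is at most [2e] in absolute value can be moved
    by multiples of [(0, m)] into the cube of radius [2e], so that coordinate
    is [0]; on the other hand, the point of [L] within [e] of [(e+1, 0)] has
    first coordinate between [1] and [m].  Hence that point is [(m, s)] for
    some [s], and Euclidean division of both coordinates by [m] shows that
    [(m, s)] and [(0, m)] generate [L] ([type2_perfect_triangular]).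

    It remains to see which [s] occur.  A code modulo [q = mt] must have
    [(q, 0)] in its lattice, that is, [t (m, s) - (q, 0) = (0, ts)] must be a
    multiple of [(0, m)].  The condition [m | ts] amounts to
    [m / gcd(m, t) | s] ([dvdz_mul_gcd]).  Conversely it makes the lattice
    stable under [q Z^2], hence the lattice of a code, and that code is
    perfect because each coordinate in turn can be rounded to a multiple of
    [m] with an error at most [e] ([triangular_perfect]). *)

(** * Integer representatives modulo q *)

Lemma Zp_intr_eq0 (q : nat) (z : int) :
  (1 < q)%N -> ((z%:~R : 'Z_q) == 0) = (q %| `|z|)%N.
Proof.
move=> q_gt1.
have natE (n : nat) : ((n%:R : 'Z_q) == 0) = (q %| n)%N.
  by rewrite -val_eqE /= val_Zp_nat.
case: z => n; first exact: natE.
by rewrite NegzE rmorphN /= oppr_eq0 natE; congr (_ %| _)%N; lia.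
Qed.

Lemma ltn_Zp (q : nat) (a : 'Z_q) : (1 < q)%N -> (a < q)%N.
Proof. by move=> q_gt1; rewrite -[X in (_ < X)%N](Zp_cast q_gt1) ltn_ord. Qed.

Lemma absZN (q : nat) (a : 'Z_q) : (1 < q)%N -> absZ (- a) = absZ a.
Proof.
move=> q_gt1; have a_lt := ltn_Zp q a q_gt1.
have -> : - a = (q - a)%N%:R.
  by rewrite natrB ?(ltnW a_lt) // pchar_Zp // sub0r natr_Zp.
rewrite /absZ val_Zp_nat //.
case: (posnP a) a_lt => [-> _ | a_gt0 a_lt]; first by rewrite subn0 modnn; lia.
by rewrite modn_small; lia.
Qed.

(** [absZ a] is the least absolute value of an integer in the class of [a]. *)
Lemma absZ_leP (q r : nat) (a : 'Z_q) : (1 < q)%N ->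
  (absZ a <= r)%N <-> exists2 z : int, a = z%:~R & (`|z| <= r)%N.
Proof.
move=> q_gt1; split=> [|[z ->]].
  have a_lt := ltn_Zp q a q_gt1.
  rewrite /absZ geq_min => /orP[le_ar | le_qar].
    by exists (a : nat)%:Z; rewrite // [RHS]natr_Zp.
  exists ((a : nat)%:Z - q%:Z); last by lia.
  by rewrite rmorphB /= -!pmulrn pchar_Zp // subr0 natr_Zp.
have nat_case (n : nat) : (n <= r)%N -> (absZ (n%:R : 'Z_q) <= r)%N.
  move=> le_nr; rewrite /absZ geq_min val_Zp_nat //.
  by rewrite (leq_trans (leq_mod n q) le_nr).
case: z => n le_nr; first exact: nat_case.
by rewrite NegzE rmorphN /= absZN // nat_case //; lia.
Qed.

Lemma dist_max_leP (q n r : nat) (x y : 'rV['Z_q]_n) : (1 < q)%N ->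
  (dist_max x y <= r)%N <->
  exists2 u : 'rV[int]_n, x - y = mod_vec q u & forall i, (`|u ord0 i| <= r)%N.
Proof.
move=> q_gt1; split=> [/bigmax_leqP le_r | [u xyE u_le]].
  have /fin_all_exists2[f fE f_le] i :
      exists2 z : int, x ord0 i - y ord0 i = z%:~R & (`|z| <= r)%N.
    by apply/absZ_leP => //; apply: le_r.
  exists (\row_i f i) => [|i]; last by rewrite mxE f_le.
  by apply/rowP=> i; rewrite !mxE fE.
apply/bigmax_leqP=> i _; apply/absZ_leP => //; exists (u ord0 i) => //.
by have /rowP/(_ i) := xyE; rewrite !mxE.
Qed.

Lemma mod_vecB (q n : nat) (u v : 'rV[int]_n) :
  mod_vec q (u - v) = mod_vec q u - mod_vec q v.
Proof. exact: map_mxB. Qed.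

Lemma mod_vec_eq0 (q n : nat) (u : 'rV[int]_n) : (1 < q)%N ->
  mod_vec q u = 0 <-> forall i, (q %| `|u ord0 i|)%N.
Proof.
move=> q_gt1; split=> [/rowP u0 i | q_u].
  by rewrite -Zp_intr_eq0 //; have := u0 i; rewrite !mxE => ->.
by apply/rowP=> i; rewrite !mxE; apply/eqP; rewrite Zp_intr_eq0.
Qed.

Definition lift_vec (q n : nat) (x : 'rV['Z_q]_n) : 'rV[int]_n :=
  map_mx (fun a : 'Z_q => (a : nat)%:Z) x.

Arguments lift_vec {q n} x.

Lemma lift_vecK (q n : nat) : cancel (@lift_vec q n) (@mod_vec q n).
Proof. by move=> x; apply/rowP=> i; rewrite !mxE [LHS]natr_Zp. Qed.

(** * Perfect codes and their lattices *)

Lemma int_halve (e : nat) (z : int) : (`|z| <= 2 * e)%N ->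
  exists2 x : int, (`|x| <= e)%N & (`|(x - z)%R| <= e)%N.
Proof.
move=> z_le; have [lt_ez|le_ze] := boolP (e%:Z < z)%R; first by exists e%:Z; lia.
have [lt_ze|le_ez] := boolP (z < - e%:Z)%R; first by exists (- e%:Z); lia.
by exists z; lia.
Qed.

(** Two balls of radius [e] meet exactly when the difference of their centres
    has a representative in the cube of radius [2e], because an integer of
    absolute value at most [2e] is a sum of two of absolute value at most [e].
    The bound [2e < q] ensures that the cube of radius [2e] contains no nonzero
    vector congruent to [0]. *)
Lemma LPL_latticeP (q n e : nat) (C : {set 'rV['Z_q]_n}) :
  (1 < q)%N -> (2 * e < q)%N ->
  LPL e C <->
  [/\ GRing.zmod_closed C, (1 < #|C|)%N,
      forall v : 'rV[int]_n, exists2 w : 'rV[int]_n,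
        w \in code_lattice C & forall i, (`|(w ord0 i - v ord0 i)%R| <= e)%N
    & forall w : 'rV[int]_n, w \in code_lattice C ->
        (forall i, (`|w ord0 i| <= 2 * e)%N) -> w = 0].
Proof.
move=> q_gt1 e_lt; split=> [[Czmod C_gt1 cov disj] | [Czmod C_gt1 cov pack]].
  split=> // [v | w wL w_le].
    have : mod_vec q v \in \bigcup_(c in C) ball_max c e by rewrite cov inE.
    case/bigcupP=> c cC; rewrite inE => /(dist_max_leP _ _ _ _ _ q_gt1)[u uE u_le].
    exists (v + u) => [|i]; last by rewrite !mxE addrAC subrr add0r.
    rewrite inE; suff -> : mod_vec q (v + u) = c by [].
    by rewrite [mod_vec q _]map_mxD -!/(mod_vec q _) -uE addrC subrK.
  have w0 : mod_vec q w = 0.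
    apply/eqP/negPn/negP=> w_neq0.
    have halve i := int_halve e (w ord0 i) (w_le i).
    have [f f_le fw_le] := fin_all_exists2 halve.
    have /disjointFr disjF := disj _ _ wL (proj1 Czmod) w_neq0.
    suff [inw in0] : mod_vec q (\row_i f i) \in ball_max (mod_vec q w) e /\
        mod_vec q (\row_i f i) \in ball_max 0 e by rewrite disjF in in0.
    rewrite !inE; split; apply/dist_max_leP => //.
      exists (w - \row_i f i); first by rewrite mod_vecB.
      by move=> i; rewrite !mxE distnC fw_le.
    exists (0 - \row_i f i) => [|i].
      by rewrite mod_vecB; congr (_ - _); apply/rowP=> i; rewrite !mxE.
    by rewrite !mxE sub0r abszN f_le.
  apply/rowP=> i; rewrite mxE.
  have /(mod_vec_eq0 _ _ _ q_gt1)-/(_ i) q_wi := w0.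
  apply/eqP; rewrite -absz_eq0; case: posnP => // wi_gt0.
  by have := leq_ltn_trans (w_le i) e_lt; rewrite ltnNge dvdn_leq.
split=> // [|c c' cC c'C].
  apply/setP=> y; rewrite inE; apply/bigcupP.
  have [w wL w_le] := cov (lift_vec y).
  exists (mod_vec q w) => //; rewrite inE; apply/dist_max_leP => //.
  exists (w - lift_vec y); first by rewrite mod_vecB lift_vecK.
  by move=> i; have := w_le i; rewrite !mxE.
apply: contraR => /pred0Pn[y]; rewrite !inE /= => /andP[].
move=> /(dist_max_leP _ _ _ _ _ q_gt1)[u uE u_le].
move=> /(dist_max_leP _ _ _ _ _ q_gt1)[u' u'E u'_le].
have ccE : c - c' = mod_vec q (u - u').
  by rewrite mod_vecB -uE -u'E opprB addrA subrK.
rewrite -subr_eq0 ccE (pack (u - u')).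
- by apply/eqP/rowP=> i; rewrite !mxE.
- by rewrite inE -ccE (proj2 Czmod).
move=> i; rewrite !mxE; move: (u_le i) (u'_le i).
by move: (u ord0 i) (u' ord0 i) => z1 z2; lia.
Qed.

(** * Triangular lattices in the plane *)

(** Coordinate form of membership in the lattice spanned by [(m, s)] and
    [(0, m)]. *)
Definition tri (m s : int) (v : 'rV[int]_2) : Prop :=
  exists a b : int, v ord0 ord0 = a * m /\ v ord0 ord_max = a * s + b * m.

(** A boolean test, so that a code can be carved out of ['Z_q]-vectors by
    comprehension. *)
Definition trib (m s : int) (v : 'rV[int]_2) : bool :=
  (m %| v ord0 ord0)%Z &&
  (m %| v ord0 ord_max - (v ord0 ord0 %/ m)%Z * s)%Z.

Lemma row2P (u v : 'rV[int]_2) :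
  u ord0 ord0 = v ord0 ord0 -> u ord0 ord_max = v ord0 ord_max -> u = v.
Proof.
move=> eq0 eq1; apply/rowP=> -[[|[|//]] lt_i].
  by have -> : Ordinal lt_i = ord0 by apply: val_inj.
by have -> : Ordinal lt_i = ord_max by apply: val_inj.
Qed.

Lemma forall_ord2 (P : 'I_2 -> Prop) : P ord0 -> P ord_max -> forall i, P i.
Proof.
move=> P0 P1 [[|[|//]] lt_i].
  by have -> : Ordinal lt_i = ord0 by apply: val_inj.
by have -> : Ordinal lt_i = ord_max by apply: val_inj.
Qed.

Definition row2 (a b : int) : 'rV[int]_2 :=
  \row_(j < 2) if j == ord0 then a else b.

Lemma row2E (a b : int) :
  (row2 a b ord0 ord0 = a) * (row2 a b ord0 ord_max = b).
Proof. by rewrite !mxE. Qed.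

Lemma mod_vec_row2 (q n : nat) :
  mod_vec q (row2 0 n%:Z) = n%:R *: delta_mx ord0 ord_max.
Proof. by apply/rowP; apply: forall_ord2; rewrite !mxE /= ?mulr0 ?mulr1. Qed.

Lemma triP (m s : int) (v : 'rV[int]_2) :
  m != 0 -> trib m s v <-> tri m s v.
Proof.
move=> m_neq0; split=> [/andP[/dvdzP[a v0E] /dvdzP[b]] | [a [b [v0E v1E]]]].
  rewrite v0E mulzK // => v1E; exists a, b; split=> //.
  by rewrite -v1E addrC subrK.
by rewrite /trib v0E v1E dvdz_mull //= mulzK // addrAC subrr add0r dvdz_mull.
Qed.

Lemma tri_sub (m s : int) (u v : 'rV[int]_2) :
  tri m s u -> tri m s v -> tri m s (u - v).
Proof.
move=> [a [b [u0 u1]]] [c [d [v0 v1]]]; exists (a - c), (b - d).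
by rewrite !mxE u0 u1 v0 v1; split; ring.
Qed.

(** The two rows are always independent when [m] is nonzero, so that only their
    span matters. *)
Lemma generator_matrix_triP (q : nat) (C : {set 'rV['Z_q]_2}) (m s : int) :
  m != 0 ->
  generator_matrix C (mx2 m s 0 m) <->
  forall v : 'rV[int]_2, v \in code_lattice C <-> tri m s v.
Proof.
move=> m_neq0.
have combE (a : 'I_2 -> int) :
    \sum_(i < 2) a i *: row i (mx2 m s 0 m) =
    row2 (a ord0 * m) (a ord0 * s + a ord_max * m).
  rewrite big_ord_recl big_ord1; have -> : lift ord0 ord0 = ord_max :> 'I_2.
    exact: val_inj.
  by apply: row2P; rewrite row2E !mxE /= ?mulr0 ?addr0.
have spanE (v : 'rV[int]_2) :
    (exists a : 'I_2 -> int, v = \sum_(i < 2) a i *: row i (mx2 m s 0 m)) <->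
    tri m s v.
  split=> [[a ->] | [a [b [v0 v1]]]].
    by rewrite combE; exists (a ord0), (a ord_max); rewrite !row2E.
  exists (fun i => if i == ord0 then a else b).
  by rewrite combE; apply: row2P; rewrite row2E.
split=> [[span _] v | latE]; first by rewrite span spanE.
split=> [v | a]; first by rewrite spanE latE.
rewrite combE => /rowP a0; have := a0 ord0; have := a0 ord_max.
rewrite !row2E !mxE => a1E /eqP; rewrite mulf_eq0 (negPf m_neq0) orbF.
move=> /eqP a0E; move: a1E; rewrite a0E mul0r add0r => /eqP.
by rewrite mulf_eq0 (negPf m_neq0) orbF => /eqP a1E; apply: forall_ord2.
Qed.

(** The integers [m / gcd(m, t)] and [t / gcd(m, t)] are coprime. *)
Lemma dvdz_mul_gcd (m t : nat) (s : int) : (0 < m)%N ->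
  (m %| t%:Z * s)%Z = ((m %/ gcdn m t)%N %| s)%Z.
Proof.
move=> m_gt0; rewrite !dvdzE abszM /=.
have d_gt0 : (0 < gcdn m t)%N by rewrite gcdn_gt0 m_gt0.
have cop : coprime (m %/ gcdn m t) (t %/ gcdn m t).
  rewrite /coprime -(eqn_pmul2r d_gt0) muln_gcdl.
  by rewrite !divnK ?dvdn_gcdl ?dvdn_gcdr // mul1n.
rewrite -[in LHS](divnK (dvdn_gcdl m t)) -[X in (_ %| X * _)%N](divnK (dvdn_gcdr m t)).
by rewrite mulnAC dvdn_pmul2r // Gauss_dvdr.
Qed.

(** The residues modulo [2e+1] have representatives in [[-e, e]]. *)
Lemma round_mul (e : nat) (z : int) :
  exists a : int, (`|(a * (2 * e + 1)%N%:Z - z)%R| <= e)%N.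
Proof.
exists ((z + e%:Z) %/ (2 * e + 1)%N%:Z)%Z.
have m_neq0 : (2 * e + 1)%N%:Z != 0 by lia.
have := divz_eq (z + e%:Z) (2 * e + 1)%N%:Z.
have := modz_ge0 (z + e%:Z) m_neq0.
have := ltz_mod (z + e%:Z) m_neq0.
set a := divz _ _; set r := modz _ _; set p := a * _; lia.
Qed.

(** * Type 2 perfect codes in the plane *)

Lemma triangular_perfect (e t : nat) (s : int) :
  (1 < t)%N -> ((2 * e + 1)%N %| t%:Z * s)%Z ->
  exists C : {set 'rV['Z_((2 * e + 1) * t)]_2},
    LPL2_o e C /\ generator_matrix C (mx2 (2 * e + 1)%N%:Z s 0 (2 * e + 1)%N%:Z).
Proof.
move=> t_gt1; set m := (2 * e + 1)%N; set q := (m * t)%N => m_ts.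
have q_gt1 : (1 < q)%N by rewrite /q /m; nia.
have e_lt : (2 * e < q)%N by rewrite /q /m; nia.
have m_neq0 : m%:Z != 0 by rewrite /m; lia.
(* Divisibility of [ts] by [m] makes the lattice stable under [q Z^2]. *)
have tri_mod0 u : mod_vec q u = 0 -> tri m s u.
  move=> /(mod_vec_eq0 _ _ _ q_gt1) q_u.
  have /dvdzP[x u0] : (q %| u ord0 ord0)%Z := q_u ord0.
  have /dvdzP[y u1] : (q %| u ord0 ord_max)%Z := q_u ord_max.
  have /dvdzP[c tsE] := m_ts.
  exists (x * t%:Z), (y * t%:Z - x * c).
  rewrite u0 u1 /q PoszM; split; first by ring.
  by rewrite -mulrA tsE; ring.
(* By this stability, membership does not depend on the representatives that
   [lift_vec] chooses. *)
pose C := [set c : 'rV['Z_q]_2 | trib m s (lift_vec c)].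
have latE v : v \in code_lattice C <-> tri m s v.
  rewrite inE inE triP //.
  have congr0 : mod_vec q (v - lift_vec (mod_vec q v)) = 0.
    by rewrite mod_vecB lift_vecK subrr.
  have tri_diff := tri_mod0 _ congr0.
  split=> tri_v; last by have := tri_sub _ _ _ _ tri_v tri_diff; rewrite subKr.
  have tri0 : tri m s 0 by exists 0, 0; rewrite !mxE !mul0r addr0.
  have := tri_sub _ _ _ _ tri_diff (tri_sub _ _ _ _ tri0 tri_v).
  by rewrite sub0r opprK subrK.
have memE c : c \in C <-> tri m s (lift_vec c).
  by rewrite inE triP.
have modC v : tri m s v -> mod_vec q v \in C by move/latE.
have C0 : (0 : 'rV['Z_q]_2) \in C.
  by apply/memE; exists 0, 0; rewrite !mxE !mul0r addr0.
have mC : mod_vec q (row2 0 m%:Z) \in C.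
  by apply: modC; exists 0, 1; rewrite !row2E !mul0r mul1r add0r.
have CB : {in C &, forall x y, x - y \in C}.
  move=> x y /memE tx /memE ty; rewrite -[x]lift_vecK -[y]lift_vecK -mod_vecB.
  exact/modC/tri_sub.
exists C; split; last exact/generator_matrix_triP.
split.
  apply/LPL_latticeP => //; split=> // [|v|w].
  - rewrite (cardsD1 0) C0 add1n ltnS card_gt0; apply/set0Pn.
    exists (mod_vec q (row2 0 m%:Z)); rewrite in_setD1 mC andbT.
    apply/eqP=> /(mod_vec_eq0 _ _ _ q_gt1)/(_ ord_max); rewrite row2E /=.
    by move/dvdn_leq; rewrite /q /m; nia.
  - have [a a_le] := round_mul e (v ord0 ord0).
    have [b b_le] := round_mul e (v ord0 ord_max - a * s).
    exists (row2 (a * m%:Z) (a * s + b * m%:Z)).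
      by apply/latE; exists a, b; rewrite !row2E.
    apply: forall_ord2; rewrite row2E //.
    by rewrite [a * s + _]addrC -addrA -[a * s - _]opprB.
  case/latE=> a [b [w0 w1]] w_le.
  have w0_le := w_le ord0; have w1_le := w_le ord_max.
  have small x : (`|(x * m%:Z)%R| <= 2 * e)%N -> x = 0.
    by rewrite abszM /m /=; nia.
  have a0 : a = 0 by apply: small; rewrite -w0.
  move: w1; rewrite a0 mul0r add0r => w1.
  have b0 : b = 0 by apply: small; rewrite -w1.
  by apply: row2P; rewrite mxE ?w0 ?w1 ?a0 ?b0 mul0r.
apply/subsetP=> _ /imsetP[c cC ->].
rewrite -mod_vec_row2.
by have := CB _ _ cC (CB _ _ C0 mC); rewrite sub0r opprK.
Qed.

Lemma type2_perfect_triangular (e t : nat) (C : {set 'rV['Z_((2 * e + 1) * t)]_2}) :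
  (1 < t)%N -> LPL2_o e C ->
  exists2 s : int, ((2 * e + 1)%N %| t%:Z * s)%Z &
    generator_matrix C (mx2 (2 * e + 1)%N%:Z s 0 (2 * e + 1)%N%:Z).
Proof.
move: C; set m := (2 * e + 1)%N; set q := (m * t)%N => C t_gt1.
have q_gt1 : (1 < q)%N by rewrite /q /m; nia.
have e_lt : (2 * e < q)%N by rewrite /q /m; nia.
have m_neq0 : m%:Z != 0 by rewrite /m; lia.
case=> /(LPL_latticeP _ _ _ _ q_gt1 e_lt)[[C0 CB] _ cov pack] /subsetP C_type2.
pose L (x y : int) := row2 x y \in code_lattice C.
have LB x y x' y' : L x y -> L x' y' -> L (x - x') (y - y').
  rewrite /L !inE => Lx Lx'; have := CB _ _ Lx Lx'; rewrite -mod_vecB.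
  suff -> : row2 x y - row2 x' y' = row2 (x - x') (y - y') by [].
  by apply: row2P; rewrite !mxE.
have L00 : L 0 0.
  rewrite /L inE; suff -> : mod_vec q (row2 0 0) = 0 by [].
  by apply/rowP=> i; rewrite !mxE if_same.
have LD x y x' y' : L x y -> L x' y' -> L (x + x') (y + y').
  by move=> Lx Lx'; have := LB _ _ _ _ Lx (LB _ _ _ _ L00 Lx'); rewrite !sub0r !opprK.
have LM x y a : L x y -> L (a * x) (a * y).
  move=> Lxy; have Ln (n : nat) : L (n%:Z * x) (n%:Z * y).
    elim: n => [|n IHn]; first by rewrite !mul0r.
    by rewrite -addn1 PoszD !mulrDl !mul1r; apply: LD.
  case: a => n //; rewrite NegzE !mulNr -[- (_ * x)]sub0r -[- (_ * y)]sub0r.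
  exact: LB.
have Lm : L 0 m.
  rewrite /L inE.
  rewrite mod_vec_row2; have := C_type2 _ (imset_f _ C0).
  by rewrite add0r.
have Lq : L q 0.
  rewrite /L inE; suff -> : mod_vec q (row2 q 0) = 0 by [].
  apply/(mod_vec_eq0 _ _ _ q_gt1); apply: forall_ord2.
    by rewrite row2E /= dvdnn.
  by rewrite row2E /= dvdn0.
have Lpack x y : L x y -> (`|x| <= 2 * e)%N -> (`|y| <= 2 * e)%N -> x = 0 /\ y = 0.
  move=> Lxy x_le y_le.
  have /rowP xy0 : row2 x y = 0 by apply: pack => //; apply: forall_ord2; rewrite row2E.
  by have := xy0 ord0; have := xy0 ord_max; rewrite !row2E !mxE.
(* Adding a multiple of [(0, m)] brings the second coordinate into [[-e, e]]. *)
have Lfst x y : L x y -> (`|x| <= 2 * e)%N -> x = 0.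
  move=> Lxy x_le; have [b b_le] := round_mul e y.
  have := LB _ _ _ _ Lxy (LM _ _ b Lm); rewrite mulr0 subr0 => Lxb.
  by have [|//] := Lpack _ _ Lxb x_le; rewrite -/m in b_le; lia.
(* A point within [e] of [(e + 1, 0)] has first coordinate between [1] and
   [m], and [Lfst] excludes the values below [m]. *)
have [s Ls] : exists s, L m s.
  have [w wL w_le] := cov (row2 e.+1 0).
  have w0_le := w_le ord0; rewrite row2E in w0_le.
  have Lw : L (w ord0 ord0) (w ord0 ord_max).
    by rewrite /L; suff -> : row2 (w ord0 ord0) (w ord0 ord_max) = w
      by []; apply: row2P; rewrite row2E.
  exists (w ord0 ord_max); have := Lfst _ _ Lw.
  suff: (`|w ord0 ord0| <= 2 * e)%N \/ w ord0 ord0 = m :> int.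
    by case=> [le2e /(_ le2e) | <- //]; lia.
  by rewrite /m; lia.
have Ltri x y : L x y -> exists a b : int, x = a * m%:Z /\ y = a * s + b * m%:Z.
  move=> Lxy.
  have rem_le (z : int) : (`|(z %% m)%Z| <= 2 * e)%N.
    have := modz_ge0 z m_neq0; have := ltz_mod z m_neq0; rewrite /m; lia.
  pose a := (x %/ m)%Z; pose b := ((y - a * s) %/ m)%Z.
  have xE : x = a * m%:Z + (x %% m)%Z := divz_eq x m.
  have yE : y - a * s = b * m%:Z + ((y - a * s) %% m)%Z := divz_eq _ m.
  have := LB _ _ _ _ (LB _ _ _ _ Lxy (LM _ _ a Ls)) (LM _ _ b Lm).
  rewrite mulr0 subr0 {1}xE yE addrAC subrr add0r addrAC subrr add0r.
  case/Lpack=> // x0 y0; exists a, b; rewrite {1}xE x0 addr0; split=> //.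
  by rewrite -[y](subrK (a * s)) yE y0 addr0 addrC.
exists s.
  have := LB _ _ _ _ (LM _ _ t%:Z Ls) Lq.
  rewrite subr0 => /Ltri[a [b [/eqP]]].
  rewrite /q PoszM [m%:Z * _]mulrC subrr eq_sym mulf_eq0 (negPf m_neq0) orbF.
  by move=> /eqP-> ->; rewrite mul0r add0r dvdz_mull.
apply/generator_matrix_triP => // v.
have vE : v = row2 (v ord0 ord0) (v ord0 ord_max) by apply: row2P; rewrite row2E.
split; first by rewrite {1}vE; apply: Ltri.
case=> a [b [v0 v1]]; rewrite vE v0 v1.
have := LD _ _ _ _ (LM _ _ a Ls) (LM _ _ b Lm).
by rewrite mulr0 addr0.
Qed.

Theorem theorem3p10 (e t q d1 h1 : nat) (ht : (1 < t)%N)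
    (hq : q = ((2 * e + 1) * t)%N)
    (hd1 : d1 = gcdn (2 * e + 1) t)
    (hh1 : h1 = ((2 * e + 1) %/ d1)%N) :
  (forall k : int,
     exists C : {set 'rV['Z_q]_2},
       LPL2_o e C
       /\ generator_matrix C (mx2 (2 * e + 1)%N%:Z (k * h1%:Z) 0 (2 * e + 1)%N%:Z))
  /\
  (forall C : {set 'rV['Z_q]_2},
     LPL2_o e C ->
     exists k : int,
       generator_matrix C (mx2 (2 * e + 1)%N%:Z (k * h1%:Z) 0 (2 * e + 1)%N%:Z)).
Proof.
have m_gt0 : (0 < 2 * e + 1)%N by rewrite addn1.
subst q d1 h1; split=> [k | C /(type2_perfect_triangular _ _ _ ht)[s]].
  by apply: triangular_perfect => //; rewrite dvdz_mul_gcd // dvdz_mull.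
by rewrite dvdz_mul_gcd // => /dvdzP[k ->] genM; exists k.
Qed.
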